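(* Let $q_\varepsilon(t)$ be any space change of the trajectory $t\mapsto q(t)$, $t\in I$, and let $t_0\in I$. Suppose that $t\mapsto q(t)$ is a solution to the Lagrange equation. Then the following function is constant on $I$: $$t\mapsto \partial_{\dot q}L\bigl(t,q(t),\dot q(t)\bigr)\cdot\partial_\varepsilon q_\varepsilon(t)\big|_{\varepsilon=0}-\int_{t_0}^t\frac{\partial}{\partial\varepsilon}L\bigl(s,q_\varepsilon(s),\dot q_\varepsilon(s)\bigr)\Big|_{\varepsilon=0}ds .$$
   Context: Let $n\ge1$ and let $L=L(t,q,\dot q)$ (the Lagrangian) be a smooth real-valued function on an open subset of $\mathbb{R}\times\mathbb{R}^n\times\mathbb{R}^n$. The symbols $\partial_qL,\partial_{\dot q}L$ denote the gradients with respect to the second and third arguments, viewed as vectors of $\mathbb{R}^n$; $x\cdot y$ is the Euclidean inner product; a dot over a function denotes the derivative in $t$. Let $t\mapsto q(t)\in\mathbb{R}^n$ be a smooth trajectory on an open interval $I$ such that $(t,q(t),\dot q(t))$ lies in the domain of $L$ for all $t\in I$. It is a solution to the Lagrange equation if $\frac{d}{dt}\partial_{\dot q}L(t,q(t),\dot q(t))-\partial_qL(t,q(t),\dot q(t))=0$ for all $t\in I$. A space change of $q$ is a smooth one-parameter family $(\varepsilon,t)\mapsto q_\varepsilon(t)\in\mathbb{R}^n$, defined on an open neighbourhood of $\{0\}\times I$ in $\mathbb{R}\times I$ (i.e. for $t\in I$ and $\varepsilon$ close to $0$), with $q_0(t)=q(t)$ for all $t\in I$; $\dot q_\varepsilon(t)$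 denotes $\partial_t q_\varepsilon(t)$. *)

(* Defs.v *)
From HB Require Import structures.
From mathcomp Require Import all_boot all_order all_algebra.
From mathcomp Require Import all_classical all_reals all_analysis.

Set Implicit Arguments.
Unset Strict Implicit.
Unset Printing Implicit Defensive.

Import Order.TTheory GRing.Theory Num.Theory.
Import numFieldNormedType.Exports.

Local Open Scope ring_scope.
Local Open Scope classical_set_scope.

(* To be used with A open, V finite-dimensional: f is C^(k+1) on A iff it is
   differentiable at each point of A and its derivative is C^k, i.e. (V being
   finite-dimensional) each directional derivative is C^k. *)
Fixpoint Ck (R : realType) (V W : normedModType R) (k : nat) (A : set V)
    (f : V -> W) : Prop :=
  if k is k'.+1 then
    (forall x, A x -> differentiable f x) /\ (forall v, Ck k' A ('D_v f))
  else forall x, A x -> {for x, continuous f}.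

Definition smooth (R : realType) (V W : normedModType R) (A : set V)
    (f : V -> W) : Prop :=
  forall k, Ck k A f.

Definition gradient (R : realType) (n : nat) (f : 'rV[R]_n -> R)
    (x : 'rV[R]_n) : 'rV[R]_n :=
  \row_j 'D_(delta_mx 0 j) f x.

Definition dot (R : realType) (n : nat) (x y : 'rV[R]_n) : R :=
  \sum_j x 0 j * y 0 j.

(* Also meaningful for b < a, with the usual sign convention. *)
Definition oriented_integral (R : realType) (f : R -> R) (a b : R) : R :=
  if a <= b then Rintegral lebesgue_measure `[a, b] f
  else - Rintegral lebesgue_measure `[b, a] f.

Section Lagrangian.
Variables (R : realType) (n : nat).
Variable L : R * 'rV[R]_n * 'rV[R]_n -> R.

Definition grad_q (p : R * 'rV[R]_n * 'rV[R]_n) : 'rV[R]_n :=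
  gradient (fun x => L (p.1.1, x, p.2)) p.1.2.

Definition grad_dq (p : R * 'rV[R]_n * 'rV[R]_n) : 'rV[R]_n :=
  gradient (fun v => L (p.1.1, p.1.2, v)) p.2.

Definition lift_traj (q : R -> 'rV[R]_n) (t : R) : R * 'rV[R]_n * 'rV[R]_n :=
  (t, q t, q^`()%classic t).

Definition trajectory (Omega : set (R * 'rV[R]_n * 'rV[R]_n)) (I : set R)
    (q : R -> 'rV[R]_n) : Prop :=
  smooth I q /\ forall t, I t -> Omega (lift_traj q t).

Definition lagrange_solution (I : set R) (q : R -> 'rV[R]_n) : Prop :=
  forall t, I t ->
    (fun s => grad_dq (lift_traj q s))^`()%classic t - grad_q (lift_traj q t) = 0.

End Lagrangian.

(* Q e t stands for q_e(t); its values off the neighbourhood U of {0} x I are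
   irrelevant. *)
Definition space_change (R : realType) (n : nat) (I : set R)
    (q : R -> 'rV[R]_n) (Q : R -> R -> 'rV[R]_n) : Prop :=
  exists U : set (R * R),
    [/\ open U,
        U `<=` [set: R] `*` I,
        [set 0] `*` I `<=` U,
        smooth U (fun p : R * R => Q p.1 p.2) &
        forall t, I t -> Q 0 t = q t].

(* Main.v *)
Require Import Defs.
From HB Require Import structures.
From mathcomp Require Import all_boot all_order all_algebra.
From mathcomp Require Import all_classical all_reals all_analysis.

Set Implicit Arguments.
Unset Strict Implicit.
Unset Printing Implicit Defensive.

Import Order.TTheory GRing.Theory Num.Theory.
Import numFieldNormedType.Exports.

Local Open Scope ring_scope.
Local Open Scope classical_set_scope.

(** Write p(t) for the momentum, that is the gradient of L in the velocity at
    (t, q(t), q'(t)), and h(t) for the variation, the derivative of q_e(t) in e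
    at e = 0. By the product rule (p . h)' = p' . h + p . h', and the Lagrange
    equation replaces p' by the gradient of L in the position. On the other
    side, the chain rule at e = 0 turns the integrand into

      (gradient in position) . h + p . (derivative in e of the velocity of q_e),

    and since q_e(t) is C^2 in (e, t), the derivative in e of the velocity is
    the velocity h' of the variation. So the integrand is the derivative of
    p . h, and by the fundamental theorem of calculus the function of the
    statement is constantly p(t0) . h(t0).

    The analytic ingredients are the symmetry of second derivatives
    ([schwarz_symmetry], then [Ck_derive_comm] for vector-valued maps), the
    chain rule for the Lagrangian ([derive_comp] with [derive_lagrangian]), and
    the fundamental theorem of calculus for oriented integrals
    ([oriented_integral_derive]), which asks for a continuous integrand: here
    the integrand is even derivable, by smoothness of L and of the family. *)

(** * Symmetry of second derivatives *)

Lemma derivable_lineE (R : realType) (V W : normedModType R) (f : V -> W)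
    (a u : V) (s : R) :
  derivable (fun r : R => f (a + r *: u)) s 1 <-> derivable f (a + s *: u) u.
Proof.
rewrite /derivable; set F := fun h => _; set G := fun h => _.
suff -> : F = G by [].
by apply/funext => h; rewrite /F /G /= [h%:A]mulr1 scalerDl addrCA addrC.
Qed.

Lemma derive_line (R : realType) (V W : normedModType R) (f : V -> W)
    (a u : V) (s : R) :
  'D_1 (fun r : R => f (a + r *: u)) s = 'D_u f (a + s *: u).
Proof.
rewrite /derive; set F := (X in X @ _); set G := (X in _ = lim (X @ _)).
suff -> : F = G by [].
by apply/funext => h; rewrite /F /G /= [h%:A]mulr1 scalerDl addrCA addrC.
Qed.

Lemma is_derive_line (R : realType) (V W : normedModType R) (f : V -> W)
    (a u : V) (s : R) : derivable f (a + s *: u) u ->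
  is_derive s 1 (fun r : R => f (a + r *: u)) ('D_u f (a + s *: u)).
Proof.
by move=> df; apply: DeriveDef; [exact/derivable_lineE|exact: derive_line].
Qed.

Lemma MVT_derivable (R : realType) (f : R -> R) (h : R) : 0 < h ->
  (forall s, 0 <= s <= h -> derivable f s 1) ->
  exists2 s : R, 0 <= s <= h & f h - f 0 = h * 'D_1 f s.
Proof.
move=> h0 df.
have df' : forall s, s \in `]0, h[%R -> is_derive s 1 f ('D_1 f s).
  move=> s; rewrite in_itv /= => /andP[s0 sh].
  by apply/derivableP/df; rewrite !ltW.
have cf : {within `[0, h], continuous f}.
  by apply: derivable_within_continuous => s; rewrite in_itv /=; exact: df.
have [s] := MVT_segment (ltW h0) df' cf.
by rewrite in_itv /= subr0 mulrC => sh E; exists s.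
Qed.

(** All intermediate points produced by the mean value theorem below lie in
    the parallelogram at x spanned by h u and h v; for small h > 0 it stays in
    any given neighbourhood of x. *)
Lemma near_parallelogram (R : realType) (V : normedModType R) (x u v : V)
    (P : set V) : (\forall y \near x, P y) ->
  \forall h \near 0^'+, forall s t : R, 0 <= s <= h -> 0 <= t <= h ->
    P (x + s *: u + t *: v).
Proof.
move=> /nbhs_ballP[r /= r0 rP].
have k0 : 0 < `|u| + `|v| + 1 by rewrite ltr_wpDl// addr_ge0.
near=> h => s t /andP[s0 sh] /andP[t0 th].
apply: rP; rewrite -ball_normE /= -addrA opprD addNKr normrN.
rewrite (le_lt_trans (ler_normD _ _))// !normrZ !ger0_norm//.
have : h * (`|u| + `|v| + 1) < r.
  rewrite -ltr_pdivlMr//; near: h; apply: nbhs_right_lt; exact: divr_gt0.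
apply: le_lt_trans; rewrite mulrDr mulr1 mulrDr -[leLHS]addr0 lerD//.
  by apply: lerD; exact: ler_wpM2r.
Unshelve. all: by end_near. Qed.

Section schwarz.
Variables (R : realType) (V : normedModType R).
Implicit Types (f : V -> R) (x u v : V).

(** Two applications of the mean value theorem, first along u and then along
    v, show that the second difference over the parallelogram is exactly h^2
    times the mixed derivative at some point of it; continuity of the mixed
    derivative at x does the rest. *)
Lemma second_difference_estimate f x u v (e : R) : 0 < e ->
  (\forall y \near x, derivable f y u) ->
  (\forall y \near x, derivable ('D_u f) y v) ->
  {for x, continuous ('D_v ('D_u f))} ->
  \forall h \near 0^'+,
    `|f (x + h *: u + h *: v) - f (x + h *: u) - f (x + h *: v) + f x
      - h ^+ 2 * 'D_v ('D_u f) x| <= h ^+ 2 * e.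
Proof.
move=> e0 dfu dfuv /cvgrPdist_le /(_ _ e0) cfuv.
pose good y := [/\ derivable f y u, derivable ('D_u f) y v &
  `|'D_v ('D_u f) x - 'D_v ('D_u f) y| <= e].
have ngood : \forall y \near x, good y.
  by apply: filterS3 dfu dfuv cfuv => y; split.
near=> h.
have nP : forall s t : R, 0 <= s <= h -> 0 <= t <= h ->
  good (x + s *: u + t *: v) by near: h; exact: near_parallelogram.
have h0 : 0 < h by [].
have hh : 0 <= h <= h by rewrite lexx ltW.
have zh : 0 <= (0 : R) <= h by rewrite lexx ltW.
(* The second difference of f is the increment of phi between 0 and h. *)
pose phi s := f (x + h *: v + s *: u) - f (x + s *: u).
have dphi s : 0 <= s <= h ->
    is_derive s 1 phi ('D_u f (x + h *: v + s *: u) - 'D_u f (x + s *: u)).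
  move=> sh; apply: is_deriveB; apply: is_derive_line.
    by have [+ _ _] := nP _ _ sh hh; rewrite [x + s *: u + _]addrAC.
  by have [] := nP _ _ sh zh; rewrite scale0r addr0.
have [s sh phiE] : exists2 s : R, 0 <= s <= h & phi h - phi 0 = h * 'D_1 phi s.
  by apply: (@MVT_derivable _ phi) => // ? /dphi[].
have [t th psiE] : exists2 t : R, 0 <= t <= h &
    'D_u f (x + s *: u + h *: v) - 'D_u f (x + s *: u + 0 *: v) =
    h * 'D_1 (fun t : R => 'D_u f (x + s *: u + t *: v)) t.
  apply: (@MVT_derivable _ (fun t : R => 'D_u f (x + s *: u + t *: v))) => //.
  move=> t th.
  by have [_ /is_derive_line[]] := nP _ _ sh th.
have -> : f (x + h *: u + h *: v) - f (x + h *: u) - f (x + h *: v) + f x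
    = h ^+ 2 * 'D_v ('D_u f) (x + s *: u + t *: v).
  have := dphi _ sh => /@derive_val sE.
  rewrite -derive_line expr2 -mulrA -psiE scale0r addr0 [x + s *: u + _]addrAC.
  rewrite -sE -phiE /phi !scale0r !addr0 opprB addrA addrAC.
  by rewrite [x + h *: u + _]addrAC.
rewrite -mulrBr normrM ger0_norm ?sqr_ge0// ler_wpM2l ?sqr_ge0//.
by rewrite distrC; have [] := nP _ _ sh th.
Unshelve. all: by end_near. Qed.

(** The second difference is symmetric in u and v, so the previous estimate
    makes both mixed derivatives the limit of the same quotient. *)
Lemma schwarz_symmetry f x u v :
  (\forall y \near x, derivable f y u /\ derivable f y v) ->
  (\forall y \near x, derivable ('D_u f) y v /\ derivable ('D_v f) y u) ->
  {for x, continuous ('D_v ('D_u f))} ->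
  {for x, continuous ('D_u ('D_v f))} ->
  'D_v ('D_u f) x = 'D_u ('D_v f) x.
Proof.
move=> df ddf cuv cvu; apply/eqP; rewrite -subr_eq0 -normr_le0.
apply/ler_addgt0Pl => e e0; rewrite addr0.
have e20 : 0 < e / 2 by rewrite divr_gt0.
have [dfu dfv] : (\near x, derivable f x u) /\ (\near x, derivable f x v).
  by split; apply: filterS df => y [].
have [dfuv dfvu] : (\near x, derivable ('D_u f) x v) /\
    (\near x, derivable ('D_v f) x u).
  by split; apply: filterS ddf => y [].
have nuv := second_difference_estimate e20 dfu dfuv cuv.
have nvu := second_difference_estimate e20 dfv dfvu cvu.
have [h [H1 [H2 h0]]] :=
  filter_ex (filterI nuv (filterI nvu (nbhs_right_gt (0 : R)))).
have h20 : 0 < h ^+ 2 by rewrite exprn_gt0.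
rewrite -(ler_pM2l h20) -{1}[h ^+ 2]gtr0_norm// -normrM mulrBr.
set D := (X in `|X - _| <= _) in H1.
have DE : f (x + h *: v + h *: u) - f (x + h *: v) - f (x + h *: u) + f x = D.
  by rewrite /D [x + h *: v + _]addrAC; congr (_ + _); exact: addrAC.
rewrite {}DE in H2.
rewrite -(subrKA D) [e in leRHS]splitr mulrDr.
rewrite distrC in H1.
exact: le_trans (ler_normD _ _) (lerD H1 H2).
Qed.

End schwarz.

Lemma near_eq_continuous (T U : topologicalType) (f g : T -> U) (x : T) :
  {near x, f =1 g} -> {for x, continuous f} -> {for x, continuous g}.
Proof.
move=> fg cf; rewrite /prop_for /continuous_at -(nbhs_singleton fg).
exact: cvg_trans (near_eq_cvg fg) cf.
Qed.

Lemma derive_coord (R : realType) (V : normedModType R) (m n : nat)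
    (f : V -> 'M[R]_(m, n)) x v i j : derivable f x v ->
  'D_v f x i j = 'D_v (fun y => f y i j) x.
Proof. by move=> df; rewrite derive_mx// mxE. Qed.

(** The scalar theorem is applied entry by entry. The derivatives of an entry
    of f are the entries of the derivatives of f only on A, hence the passages
    through equality near a point, for which A must be open. *)
Lemma Ck_derive_comm (R : realType) (V : normedModType R) (m n : nat)
    (A : set V) (f : V -> 'M[R]_(m, n)) x u v : open A -> Ck 2 A f -> A x ->
  'D_v ('D_u f) x = 'D_u ('D_v f) x.
Proof.
move=> oA [df ddf] Ax; apply/matrixP => i j.
pose g y := f y i j.
have nA y : A y -> \forall z \near y, A z by move=> Ay; exact: open_nbhs_nbhs.
have dg w y : A y -> derivable g y w.
  by move=> Ay; apply: (derivable_mxP _ _ _).1; exact/diff_derivable/df.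
have gE w y : A y -> 'D_w f y i j = 'D_w g y.
  by move=> Ay; apply: derive_coord; exact/diff_derivable/df.
have ngE w y : A y -> {near y, (fun z => 'D_w f z i j) =1 'D_w g}.
  by move=> /nA; apply: filterS => z; exact: gE.
have ddg w w' y : A y -> derivable ('D_w g) y w'.
  move=> Ay; apply: near_eq_derivable (ngE _ _ Ay) _.
  apply: (derivable_mxP _ _ _).1; have [+ _] := ddf w => /(_ _ Ay).
  exact: diff_derivable.
have g2E w w' y : A y -> 'D_w' ('D_w f) y i j = 'D_w' ('D_w g) y.
  move=> Ay; rewrite -(near_eq_derive _ (ngE _ _ Ay)); apply: derive_coord.
  by apply: diff_derivable; have [+ _] := ddf w; exact.
have cg w w' : {for x, continuous ('D_w' ('D_w g))}.
  apply: (@near_eq_continuous _ _ (fun z => 'D_w' ('D_w f) z i j)).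
    by apply: filterS (nA _ Ax) => z; exact: g2E.
  have [_ /(_ w' _ Ax) c] := ddf w.
  exact: (continuous_comp c (@coord_continuous _ _ _ _ _ _)).
apply: etrans (g2E u v _ Ax) _; apply: etrans (esym (g2E v u _ Ax)).
apply: schwarz_symmetry (cg u v) (cg v u).
  by apply: filterS (nA _ Ax) => y Ay; split; exact: dg.
by apply: filterS (nA _ Ax) => y Ay; split; exact: ddg.
Qed.

(** * Directional derivatives of composites, pairs and inner products *)

Lemma derive_comp (R : realType) (U V W : normedModType R) (g : U -> V)
    (f : V -> W) x v : differentiable g x -> differentiable f (g x) ->
  'D_v (f \o g) x = 'D_('D_v g x) f (g x).
Proof.
move=> dg df; rewrite (deriveE _ (differentiable_comp dg df)) (diff_comp dg df).
by rewrite (deriveE _ dg) (deriveE _ df).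
Qed.

Lemma derive_pair (R : realType) (U V W : normedModType R) (f : U -> V)
    (g : U -> W) x v : differentiable f x -> differentiable g x ->
  'D_v (fun y => (f y, g y)) x = ('D_v f x, 'D_v g x).
Proof.
move=> df dg; rewrite (deriveE _ (differentiable_pair df dg)) (diff_pair df dg).
by rewrite (deriveE _ df) (deriveE _ dg).
Qed.

Section dot.
Variables (R : realType) (n : nat).

Lemma derive_gradient (f : 'rV[R]_n -> R) x u : differentiable f x ->
  'D_u f x = dot (gradient f x) u.
Proof.
move=> df; rewrite (deriveE _ df) {1}[u]row_sum_delta linear_sum.
by apply: eq_bigr => j _; rewrite linearZ mxE (deriveE _ df) mulrC.
Qed.

Lemma is_derive_dot (f g : R -> 'rV[R]_n) t :
  derivable f t 1 -> derivable g t 1 ->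
  is_derive t 1 (fun s => dot (f s) (g s))
    (dot ('D_1 f t) (g t) + dot (f t) ('D_1 g t)).
Proof.
move=> df dg; rewrite /dot.
have -> : (fun s => \sum_j f s 0 j * g s 0 j) =
  \sum_(j < n) ((fun s => f s 0 j) * (fun s => g s 0 j)).
  by apply/funext => s; rewrite fct_sumE.
rewrite -big_split /=; apply: is_derive_sum => j.
have dfj := derivableP ((derivable_mxP _ _ _).1 df 0 j).
have dgj := derivableP ((derivable_mxP _ _ _).1 dg 0 j).
apply: is_derive_eq; rewrite !derive_coord// addrC.
by rewrite /GRing.scale /= [g t 0 j * _]mulrC.
Qed.

End dot.

(** * Fundamental theorem of calculus for oriented integrals *)

Section ftc.
Variables (R : realType) (I : set R) (itvI : is_interval I).

Let subI a b : I a -> I b -> `[a, b] `<=` I.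
Proof. by move=> Ia Ib x; rewrite /= in_itv; exact: itvI. Qed.

Lemma eq_oriented_integral (f g : R -> R) a b : I a -> I b ->
  (forall x, I x -> f x = g x) ->
  oriented_integral f a b = oriented_integral g a b.
Proof.
move=> Ia Ib fg; rewrite /oriented_integral.
by case: ifP => _; [|congr -%R]; apply: eq_Rintegral => x /[1!inE] /subI Ix;
  apply: fg; apply: Ix.
Qed.

Lemma oriented_integral_derive (f F : R -> R) a b : I a -> I b ->
  (forall x, I x -> is_derive x 1 F (f x)) ->
  (forall x, I x -> {for x, continuous f}) ->
  oriented_integral f a b = F b - F a.
Proof.
move=> Ia Ib dF cf.
have ftc c d : I c -> I d -> c <= d ->
    Rintegral lebesgue_measure `[c, d] f = F d - F c.
  move=> Ic Id; rewrite le_eqVlt => /predU1P[->|cd].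
    by rewrite set_itv1 Rintegral_set1 subrr.
  have cdI := subI Ic Id.
  have dF' x : x \in `[c, d]%R -> derivable F x 1.
    by move=> xcd; have [] := dF _ (cdI x xcd).
  rewrite /Rintegral (@continuous_FTC2 _ f F)//.
  - by apply: continuous_in_subspaceT => x /[1!inE] /cdI; exact: cf.
  - have cF x : x \in `[c, d]%R -> F @ x --> F x.
      by move=> xcd; exact/differentiable_continuous/derivable1_diffP/dF'.
    split.
    + by move=> x /subset_itv_oo_cc; exact: dF'.
    + by apply: cvg_at_right_filter; apply: cF; rewrite in_itv /= lexx ltW.
    + by apply: cvg_at_left_filter; apply: cF; rewrite in_itv /= lexx ltW.
  - move=> x /subset_itv_oo_cc /cdI /dF xcd.
    by rewrite derive1E; exact: derive_val.
rewrite /oriented_integral; case: leP => [ab|/ltW ba]; first exact: ftc.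
by rewrite ftc// opprB.
Qed.

End ftc.

(** * Partial derivatives as directional derivatives *)

(** A partial function and the full function along the corresponding direction
    have the same difference quotients, hence the same derivative. *)
Lemma derive_slice1 (R : realType) (U V W : normedModType R) (F : U * V -> W)
    x y u : 'D_u (fun z => F (z, y)) x = 'D_(u, 0) F (x, y).
Proof.
rewrite /derive; set f := (X in X @ _); set g := (X in _ = lim (X @ _)).
suff -> : f = g by [].
apply/funext => h; rewrite /f /g /=; congr (_ *: (F _ - _)).
by rewrite -[RHS]/(h *: u + x, h *: 0 + y) scaler0 add0r.
Qed.

Lemma derive_slice2 (R : realType) (U V W : normedModType R) (F : U * V -> W)
    x y v : 'D_v (fun z => F (x, z)) y = 'D_(0, v) F (x, y).
Proof.
rewrite /derive; set f := (X in X @ _); set g := (X in _ = lim (X @ _)).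
suff -> : f = g by [].
apply/funext => h; rewrite /f /g /=; congr (_ *: (F _ - _)).
by rewrite -[RHS]/(h *: 0 + x, h *: v + y) scaler0 add0r.
Qed.

Lemma smooth_differentiable (R : realType) (V W : normedModType R) (A : set V)
  (f : V -> W) x : smooth A f -> A x -> differentiable f x.
Proof. by move=> sf Ax; have [+ _] := sf 1%N; exact. Qed.

Lemma smooth_derive (R : realType) (V W : normedModType R) (A : set V)
  (f : V -> W) v : smooth A f -> smooth A ('D_v f).
Proof. by move=> sf k; have [_] := sf k.+1; exact. Qed.

(** * Gradients of the Lagrangian *)

Section lagrangian.
Variables (R : realType) (n : nat) (L : R * 'rV[R]_n * 'rV[R]_n -> R).
Implicit Types p : R * 'rV[R]_n * 'rV[R]_n.

Lemma derive_q_slice p u :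
  'D_u (fun x => L (p.1.1, x, p.2)) p.1.2 = 'D_(0, u, 0) L p.
Proof.
case: p => -[t x] v /=.
by rewrite -derive_slice1 -(derive_slice2 (fun z => L (z, v))).
Qed.

Lemma derive_dq_slice p w :
  'D_w (fun v => L (p.1.1, p.1.2, v)) p.2 = 'D_(0, 0, w) L p.
Proof. by case: p => -[t x] v; rewrite -derive_slice2. Qed.

(** The total derivative of L at p along a direction that does not move time;
    this is the form in which the chain rule is used along e, where time is
    fixed. *)
Lemma derive_lagrangian p u w : differentiable L p ->
  'D_(0, u, w) L p = dot (grad_q L p) u + dot (grad_dq L p) w.
Proof.
case: p => -[t x] v dL.
have -> : (0, u, w) = (0, u, 0) + (0, 0, w) :> R * 'rV[R]_n * 'rV[R]_n.
  by congr (_, _, _); rewrite /= ?addr0 ?add0r.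
rewrite (deriveE _ dL) linearD -!(deriveE _ dL).
rewrite -(derive_q_slice (t, x, v)) -(derive_dq_slice (t, x, v)) /=.
rewrite /grad_q /grad_dq /=; congr (_ + _); apply: derive_gradient.
  apply: (differentiable_comp (f := fun y => (t, y, v)) _ dL).
  apply: differentiable_pair; last exact: differentiable_cst.
  by apply: differentiable_pair; [exact: differentiable_cst|].
apply: (differentiable_comp (f := fun y => (t, x, y)) _ dL).
by apply: differentiable_pair; [exact: differentiable_cst|].
Qed.

(** The entries of both gradients are directional derivatives of L, hence
    smooth on Omega and derivable along any derivable curve. *)
Lemma derivable_grad_q (Omega : set (R * 'rV[R]_n * 'rV[R]_n))
    (c : R -> _) t :
  smooth Omega L -> Omega (c t) -> derivable c t 1 ->
  derivable (fun s => grad_q L (c s)) t 1.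
Proof.
move=> sL Oc /derivable1_diffP dc; apply/derivable_mxP => i j.
have -> : (fun s => grad_q L (c s) i j) = 'D_(0, delta_mx 0 j, 0) L \o c.
  by apply/funext => s; rewrite mxE derive_q_slice.
apply/derivable1_diffP/differentiable_comp => //.
exact: smooth_differentiable (smooth_derive _ sL) Oc.
Qed.

Lemma derivable_grad_dq (Omega : set (R * 'rV[R]_n * 'rV[R]_n))
    (c : R -> _) t :
  smooth Omega L -> Omega (c t) -> derivable c t 1 ->
  derivable (fun s => grad_dq L (c s)) t 1.
Proof.
move=> sL Oc /derivable1_diffP dc; apply/derivable_mxP => i j.
have -> : (fun s => grad_dq L (c s) i j) = 'D_(0, 0, delta_mx 0 j) L \o c.
  by apply/funext => s; rewrite mxE derive_dq_slice.
apply/derivable1_diffP/differentiable_comp => //.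
exact: smooth_differentiable (smooth_derive _ sL) Oc.
Qed.

End lagrangian.

(** * Conservation law along a space change *)

Theorem theorem3 (R : realType) (n : nat) (n_ge1 : (1 <= n)%N)
    (Omega : set (R * 'rV[R]_n * 'rV[R]_n)) (oOmega : open Omega)
    (L : R * 'rV[R]_n * 'rV[R]_n -> R) (sL : smooth Omega L)
    (I : set R) (oI : open I) (itvI : is_interval I)
    (q : R -> 'rV[R]_n) (hq : trajectory Omega I q)
    (Q : R -> R -> 'rV[R]_n) (hQ : space_change I q Q)
    (t0 : R) (It0 : I t0)
    (solq : lagrange_solution L I q) :
  exists c : R, forall t, I t ->
    dot (grad_dq L (t, q t, q^`()%classic t)) ((fun e => Q e t)^`()%classic 0)
    - oriented_integral
        (fun s => (fun e => L (s, Q e s, (Q e)^`()%classic s))^`()%classic 0) t0 t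
    = c.
Proof.
have [sq Oq] := hq.
have [U [oU _ IU sQ Q0]] := hQ.
pose Q' (p : R * R) := Q p.1 p.2.
have sQ' : smooth U Q' by exact: sQ.
have sQt : smooth U ('D_(0, 1) Q') by exact: smooth_derive.
have sQe : smooth U ('D_(1, 0) Q') by exact: smooth_derive.
have sQet : smooth U ('D_(0, 1) ('D_(1, 0) Q')) by exact: smooth_derive.
have U0 t : I t -> U (0, t) by move=> It; apply: IU; split.
have variationE e t : (Q ^~ t)^`() e = 'D_(1, 0) Q' (e, t).
  by rewrite derive1E (derive_slice1 Q').
have velocityE e t : (Q e)^`() t = 'D_(0, 1) Q' (e, t).
  by rewrite derive1E (derive_slice2 Q').
(* The family agrees with q at parameter 0 only over I; I being open, this is
   enough to identify the time derivatives. *)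
have velocity0 t : I t -> 'D_(0, 1) Q' (0, t) = q^`() t.
  move=> It; rewrite -velocityE !derive1E; apply: near_eq_derive.
  by apply: filterS (open_nbhs_nbhs (conj oI It)).
(* The momentum, the variation, and the time derivative of the variation. *)
pose P t := grad_dq L (lift_traj q t).
pose H t := (Q ^~ t)^`() 0.
pose H' t := 'D_(0, 1) ('D_(1, 0) Q') (0, t).
have dqt t : I t -> derivable (lift_traj q) t 1.
  move=> It; apply/derivable1_diffP.
  apply: differentiable_pair; first apply: differentiable_pair.
  - exact: ex_diff.
  - exact: smooth_differentiable sq It.
  have -> : q^`() = 'D_1 q by apply/funext => s; rewrite derive1E.
  exact: smooth_differentiable (smooth_derive _ sq) It.
have along (F : R * R -> 'rV[R]_n) t : smooth U F -> I t ->
    is_derive t 1 (fun s => F (0, s)) ('D_(0, 1) F (0, t)).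
  move=> sF It; rewrite -derive_slice2.
  apply/derivableP/derivable1_diffP.
  apply: (differentiable_comp (f := pair 0)).
    by apply: differentiable_pair.
  exact: smooth_differentiable sF (U0 _ It).
have dH t : I t -> is_derive t 1 H (H' t).
  move=> It; have -> : H = (fun s => 'D_(1, 0) Q' (0, s)).
    by apply/funext => s; rewrite /H variationE.
  exact: along sQe It.
have dP t : I t -> is_derive t 1 P (grad_q L (lift_traj q t)).
  move=> It; have -> : grad_q L (lift_traj q t) = 'D_1 P t.
    by apply/esym/eqP; rewrite -subr_eq0 -derive1E; apply/eqP/solq.
  exact/derivableP/(derivable_grad_dq sL (Oq _ It))/dqt.
(* The common value of the integrand and of the derivative of P . H. *)
pose g t := dot (grad_q L (lift_traj q t)) (H t) + dot (P t) (H' t).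
have dG t : I t -> is_derive t 1 (fun s => dot (P s) (H s)) (g t).
  rewrite /g => It; have [[dPt <-] [dHt <-]] := (dP t It, dH t It).
  exact: is_derive_dot.
have gE t : I t ->
    (fun e => L (t, Q e t, (Q e)^`()%classic t))^`()%classic 0 = g t.
  move=> It; have Ut := U0 t It.
  pose c e := (t, Q' (e, t), 'D_(0, 1) Q' (e, t)).
  have -> : (fun e => L (t, Q e t, (Q e)^`()%classic t)) = L \o c.
    by apply/funext => e; rewrite velocityE.
  have c0 : c 0 = lift_traj q t by rewrite /c /lift_traj velocity0// /Q' /= Q0.
  have across (F : R * R -> 'rV[R]_n) : smooth U F ->
      differentiable (fun e => F (e, t)) 0.
    move=> sF; apply: (differentiable_comp (f := pair^~ t)).
      by apply: differentiable_pair.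
    exact: smooth_differentiable sF Ut.
  have dQ := across _ sQ'.
  have dV := across _ sQt.
  have dtQ : differentiable (fun e => (t, Q' (e, t))) 0.
    exact: differentiable_pair.
  have dc : differentiable c 0 by exact: differentiable_pair.
  have dL : differentiable L (c 0).
    by rewrite c0; exact: smooth_differentiable sL (Oq _ It).
  have HE : 'D_1 (fun e => Q' (e, t)) 0 = H t by rewrite /H derive1E.
  (* The velocity is differentiated in e here and the variation in t in H'; the
     symmetry of second derivatives is what identifies the two. *)
  have H'E : 'D_1 (fun e => 'D_(0, 1) Q' (e, t)) 0 = H' t.
    apply: etrans (derive_slice1 ('D_(0, 1) Q') 0 t 1) _.
    exact: Ck_derive_comm _ _ oU (sQ' 2%N) Ut.
  have c'0 : 'D_1 c 0 = (0, H t, H' t).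
    apply: etrans (derive_pair _ dtQ dV) _; rewrite H'E.
    rewrite (derive_pair _ (differentiable_cst _ _) dQ) HE.
    by congr (_, _, _); exact: derive_cst.
  by rewrite derive1E (derive_comp _ dc dL) c'0 (derive_lagrangian _ _ dL) c0.
have cg t : I t -> {for t, continuous g}.
  move=> It; apply/differentiable_continuous/derivable1_diffP/derivableD.
    have [dHt _] := dH t It.
    by have [] := is_derive_dot (derivable_grad_q sL (Oq _ It) (dqt _ It)) dHt.
  have [[dPt _] [dH't _]] := (dP t It, along _ t sQet It).
  by have [] := is_derive_dot dPt dH't.
exists (dot (P t0) (H t0)) => t It.
rewrite (eq_oriented_integral itvI It0 It gE).
by rewrite (oriented_integral_derive itvI It0 It dG cg) subKr.
Qed.
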